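(* Let $\lambda, x, y$ be real numbers with $x \neq 1$, $|\lambda y|<1$ and $|\lambda x y|<1$. For $n\ge 0$ put $$T_n(y)=e_{\lambda}(y)-1-\frac{(1)_{1,\lambda}}{1!}y-\frac{(1)_{2,\lambda}}{2!}y^{2}-\cdots-\frac{(1)_{n,\lambda}}{n!}y^{n}=\sum_{k=n+1}^{\infty}\frac{(1)_{k,\lambda}}{k!}y^k .$$ Then $$\frac{1}{x-1}\big(e_{\lambda}(xy)-e_{\lambda}(y)\big)=\sum_{n=0}^{\infty}T_n(y)\,x^{n},$$ and $$\frac{y}{1+\lambda y}\,e_{\lambda}(y)=\sum_{n=0}^{\infty}T_n(y).$$
   Context: For real $\lambda$ the generalized falling factorials are $(x)_{0,\lambda}=1$ and $(x)_{n,\lambda}=x(x-\lambda)(x-2\lambda)\cdots(x-(n-1)\lambda)$ for $n\ge1$. The degenerate exponentials are $e_{\lambda}^{x}(t)=\sum_{n=0}^{\infty}\frac{(x)_{n,\lambda}}{n!}t^{n}$ and $e_{\lambda}(t)=e_{\lambda}^{1}(t)=\sum_{n=0}^{\infty}\frac{(1)_{n,\lambda}}{n!}t^{n}$. For $\lambda\neq 0$ and $|\lambda t|<1$ one has $e_\lambda^x(t)=(1+\lambda t)^{x/\lambda}$, and $e_0(t)=e^t$. *)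

(* Defs.v *)
From Stdlib Require Import Reals Factorial.
From Coquelicot Require Import Coquelicot.
Open Scope R_scope.

(* (x)_{n,lam} = x (x - lam) (x - 2 lam) ... (x - (n-1) lam). *)
Fixpoint gen_falling (lam x : R) (n : nat) : R :=
  match n with
  | O => 1
  | S m => gen_falling lam x m * (x - INR m * lam)
  end.

Definition deg_exp_coef (lam x : R) (n : nat) : R :=
  gen_falling lam x n / INR (fact n).

(* e_lam^x(t), defined by its power series in t for every real lam, including
   lam = 0.  [PSeries] is total, so the value is meaningful only where the series
   converges; this is the case whenever |lam t| < 1. *)
Definition deg_exp_pow (lam x t : R) : R := PSeries (deg_exp_coef lam x) t.

Definition deg_exp (lam t : R) : R := deg_exp_pow lam 1 t.

(* [sum_n a n] is a 0 + ... + a n, and the k = 0 term here is the leading 1. *)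
Definition deg_exp_tail (lam y : R) (n : nat) : R :=
  deg_exp lam y - sum_n (fun k => deg_exp_coef lam 1 k * y ^ k) n.

(* Main.v *)
Require Import Defs.
From Stdlib Require Import Reals Factorial Lia Lra.
From Coquelicot Require Import Coquelicot.
Open Scope R_scope.

(** Write [T n] for the tail of the series [sum u k] after the term of index [n].
Summation by parts gives
[(x - 1) * sum_(n <= N) T n x^n = T N x^(N+1) - sum u + sum_(n <= N) u n x^n] and
[sum_(n <= N) T n = (N + 1) T N + sum_(n <= N) n u n].
If [sum |u k| r^k] converges with [r >= 1] then [T N r^(N+1)] tends to 0, which kills
both boundary terms: take [r = max 1 |x|] for the first one and any [r > 1] for the
second.  For [u k = a k y^k], with [a] the coefficients of the degenerate exponential,
the recurrence [(n + 1) a (n + 1) = (1 - n lam) a n] shows that [B = sum n u n]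
satisfies [B = y e(y) - lam y B]. *)

(** * Tails of a convergent series and their decay *)

Definition series_tail (u : nat -> R) (n : nat) : R := Series u - sum_n u n.

Lemma series_tail_succ (u : nat -> R) (n : nat) :
  series_tail u (S n) = series_tail u n - u (S n).
Proof. unfold series_tail; rewrite sum_Sn; change plus with Rplus; ring. Qed.

Lemma is_series_series_tail (u : nat -> R) (n : nat) :
  ex_series u -> is_series (fun k => u (S n + k)%nat) (series_tail u n).
Proof.
intros Hu.
apply is_series_incr_n; [lia|].
change (is_series u (Series u - sum_n u n + sum_n u n)).
replace (Series u - sum_n u n + sum_n u n) with (Series u) by ring.
now apply Series_correct.
Qed.

Lemma is_lim_seq_series_tail (u : nat -> R) :
  ex_series u -> is_lim_seq (series_tail u) 0.
Proof.
intros Hu.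
replace (Finite 0) with (Finite (Series u - Series u)) by (f_equal; ring).
apply is_lim_seq_minus'; [apply is_lim_seq_const|].
exact (Series_correct _ Hu).
Qed.

Lemma ex_series_of_weighted (u : nat -> R) (r : R) :
  1 <= r -> ex_series (fun k => Rabs (u k) * r ^ k) -> ex_series u.
Proof.
intros Hr; apply (ex_series_le (V := R_CompleteNormedModule)); intros k.
change (Rabs (u k) <= Rabs (u k) * r ^ k).
assert (H1 := pow_R1_Rle r k Hr).
assert (H2 := Rabs_pos (u k)).
nra.
Qed.

(** Since [r >= 1], every index [k > n] has [r ^ S n <= r ^ k]. Hence [|T n| r ^ S n] is at most the
    tail after [n] of the convergent weighted series, and that tail tends to 0. *)
Lemma is_lim_seq_series_tail_mul_pow (u : nat -> R) (r : R) :
  1 <= r -> ex_series (fun k => Rabs (u k) * r ^ k) ->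
  is_lim_seq (fun n => series_tail u n * r ^ S n) 0.
Proof.
intros Hr Hv.
assert (Hu := ex_series_of_weighted u r Hr Hv).
set (v := fun k => Rabs (u k) * r ^ k) in *.
apply is_lim_seq_abs_0.
apply is_lim_seq_le_le with (u := fun _ => 0) (w := series_tail v);
  [|apply is_lim_seq_const|now apply is_lim_seq_series_tail].
intros n; split; [apply Rabs_pos|].
assert (Ht := is_series_series_tail v n Hv).
rewrite <- (is_series_unique _ _ (is_series_series_tail u n Hu)).
rewrite <- (is_series_unique _ _ Ht), <- Series_scal_r.
assert (Hle : forall k, Rabs (u (S n + k)%nat * r ^ S n) <= v (S n + k)%nat).
{ intros k; unfold v.
  rewrite Rabs_mult, (Rabs_right (r ^ S n)) by (apply Rle_ge, pow_le; lra).
  apply Rmult_le_compat_l; [apply Rabs_pos|].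
  apply Rle_pow; [lra|lia]. }
eapply Rle_trans; [apply Series_Rabs|apply Series_le].
- apply (ex_series_le (V := R_CompleteNormedModule)) with (b := fun k => v (S n + k)%nat).
  + intros k; unfold norm; simpl; unfold abs; simpl; rewrite Rabs_Rabsolu; apply Hle.
  + eexists; exact Ht.
- intros k; split; [apply Rabs_pos|apply Hle].
- eexists; exact Ht.
Qed.

(** * Summation by parts and its limit *)

(** Telescoping: [T k x^(k+1) - T k x^k] equals [T k x^(k+1) - T (k-1) x^k + u k x^k], where
    [T (-1)] stands for the full sum. *)
Lemma sum_n_series_tail_mul_pow (u : nat -> R) (x : R) (n : nat) :
  sum_n (fun k => series_tail u k * x ^ k) n * (x - 1) =
  series_tail u n * x ^ S n - Series u + sum_n (fun k => u k * x ^ k) n.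
Proof.
induction n as [|n IH].
- unfold series_tail; rewrite !sum_O; simpl; ring.
- rewrite !(sum_Sn _ n); change plus with Rplus.
  rewrite Rmult_plus_distr_r, IH, series_tail_succ; simpl pow; ring.
Qed.

(** Double counting: a term [u k] with [k <= n] lies in exactly the [k] tails [T 0, ..., T (k-1)],
    while every later term lies in all [n + 1] of them. *)
Lemma sum_n_series_tail (u : nat -> R) (n : nat) :
  sum_n (series_tail u) n =
  INR (S n) * series_tail u n + sum_n (fun k => INR k * u k) n :> R.
Proof.
induction n as [|n IH].
- unfold series_tail; rewrite !sum_O; simpl; ring.
- rewrite !(sum_Sn _ n), IH; change plus with Rplus.
  rewrite !series_tail_succ, !S_INR; ring.
Qed.

Lemma is_series_series_tail_mul_pow (u : nat -> R) (x : R) :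
  x <> 1 -> ex_series (fun k => Rabs (u k) * Rmax 1 (Rabs x) ^ k) ->
  is_series (fun n => series_tail u n * x ^ n)
    (1 / (x - 1) * (Series (fun k => u k * x ^ k) - Series u)).
Proof.
intros Hx Hv.
(* The bound [r >= 1] gives the decay of the weighted tails; the bound [r >= |x|] transfers it, and
   the convergence, to powers of [x]. *)
set (r := Rmax 1 (Rabs x)) in *.
assert (Hr : 1 <= r) by apply Rmax_l.
assert (Hux : ex_series (fun k => u k * x ^ k)).
{ revert Hv; apply (ex_series_le (V := R_CompleteNormedModule)); intros k.
  change (Rabs (u k * x ^ k) <= Rabs (u k) * r ^ k).
  rewrite Rabs_mult, <- RPow_abs.
  apply Rmult_le_compat_l; [apply Rabs_pos|].
  apply pow_incr; split; [apply Rabs_pos|apply Rmax_r]. }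
assert (Hb : is_lim_seq (fun n => series_tail u n * x ^ S n) 0).
{ apply is_lim_seq_abs_0.
  apply is_lim_seq_le_le with (u := fun _ => 0)
    (w := fun n => Rabs (series_tail u n * r ^ S n)).
  - intros n; split; [apply Rabs_pos|].
    rewrite !Rabs_mult, <- !RPow_abs.
    apply Rmult_le_compat_l; [apply Rabs_pos|].
    apply pow_incr; split; [apply Rabs_pos|].
    rewrite (Rabs_right r) by lra; apply Rmax_r.
  - apply is_lim_seq_const.
  - apply -> is_lim_seq_abs_0; now apply is_lim_seq_series_tail_mul_pow. }
change (is_lim_seq (sum_n (fun n => series_tail u n * x ^ n))
  (1 / (x - 1) * (Series (fun k => u k * x ^ k) - Series u))).
apply is_lim_seq_ext with (u := fun n => 1 / (x - 1) *
  (series_tail u n * x ^ S n - Series u + sum_n (fun k => u k * x ^ k) n)).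
- intros n; rewrite <- sum_n_series_tail_mul_pow; field; lra.
- apply is_lim_seq_scal_l with
    (lu := Finite (Series (fun k => u k * x ^ k) - Series u)).
  replace (Finite (Series (fun k => u k * x ^ k) - Series u)) with
    (Finite (0 - Series u + Series (fun k => u k * x ^ k))) by (f_equal; ring).
  apply is_lim_seq_plus'; [|exact (Series_correct _ Hux)].
  apply is_lim_seq_minus'; [exact Hb|apply is_lim_seq_const].
Qed.

(** Bernoulli's inequality [poly] for [(1 + (r - 1)) ^ n]. It lets a linear factor be absorbed by a
    geometric weight. *)
Lemma INR_le_pow_div (r : R) (n : nat) : 1 < r -> INR n <= r ^ n / (r - 1).
Proof.
intros Hr.
apply Rmult_le_reg_r with (r - 1); [lra|].
replace (r ^ n / (r - 1) * (r - 1)) with (r ^ n) by (field; lra).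
assert (H := poly n (r - 1) ltac:(lra)).
replace (1 + (r - 1)) with r in H by ring; lra.
Qed.

Lemma ex_series_INR_mul (u : nat -> R) (r : R) :
  1 < r -> ex_series (fun k => Rabs (u k) * r ^ k) ->
  ex_series (fun k => INR k * u k).
Proof.
intros Hr Hv.
apply (ex_series_le (V := R_CompleteNormedModule)) with (b := fun k => / (r - 1) * (Rabs (u k) * r ^ k)).
- intros k; change (Rabs (INR k * u k) <= / (r - 1) * (Rabs (u k) * r ^ k)).
  rewrite Rabs_mult, (Rabs_right (INR k)) by (apply Rle_ge, pos_INR).
  replace (/ (r - 1) * (Rabs (u k) * r ^ k)) with (r ^ k / (r - 1) * Rabs (u k))
    by (field; lra).
  apply Rmult_le_compat_r; [apply Rabs_pos|now apply INR_le_pow_div].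
- exact (ex_series_scal_l (K := R_AbsRing) (/ (r - 1)) _ Hv).
Qed.

Lemma is_series_sum_series_tail (u : nat -> R) (r : R) :
  1 < r -> ex_series (fun k => Rabs (u k) * r ^ k) ->
  is_series (series_tail u) (Series (fun k => INR k * u k)).
Proof.
intros Hr Hv.
(* The factor [n + 1] is at most [r ^ S n / (r - 1)], so the weighted decay of the tails
   suffices. *)
assert (Hb : is_lim_seq (fun n => INR (S n) * series_tail u n) 0).
{ apply is_lim_seq_abs_0.
  apply is_lim_seq_le_le with (u := fun _ => 0)
    (w := fun n => / (r - 1) * Rabs (series_tail u n * r ^ S n)).
  - intros n; split; [apply Rabs_pos|].
    assert (Hp : 0 <= r ^ S n) by (apply pow_le; lra).
    rewrite !Rabs_mult, (Rabs_right (INR _)) by (apply Rle_ge, pos_INR).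
    rewrite (Rabs_right (r ^ S n)) by lra.
    replace (/ (r - 1) * (Rabs (series_tail u n) * r ^ S n)) with
      (r ^ S n / (r - 1) * Rabs (series_tail u n)) by (field; lra).
    apply Rmult_le_compat_r; [apply Rabs_pos|now apply INR_le_pow_div].
  - apply is_lim_seq_const.
  - replace (Finite 0) with (Rbar_mult (/ (r - 1)) 0) by (simpl; f_equal; ring).
    apply is_lim_seq_scal_l, (is_lim_seq_abs_0 (fun n => series_tail u n * r ^ S n)).
    apply is_lim_seq_series_tail_mul_pow; [lra|exact Hv]. }
change (is_lim_seq (sum_n (series_tail u)) (Series (fun k => INR k * u k))).
apply is_lim_seq_ext with
  (u := fun n => INR (S n) * series_tail u n + sum_n (fun k => INR k * u k) n).
- intros n; symmetry; apply sum_n_series_tail.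
- replace (Series (fun k => INR k * u k)) with
    (0 + Series (fun k => INR k * u k)) by ring.
  apply is_lim_seq_plus'; [exact Hb|].
  exact (Series_correct _ (ex_series_INR_mul u r Hr Hv)).
Qed.

(** * Coefficients of the degenerate exponential and their disk of convergence *)

Lemma deg_exp_coef_succ (lam x : R) (n : nat) :
  INR (S n) * deg_exp_coef lam x (S n) = (x - INR n * lam) * deg_exp_coef lam x n.
Proof.
unfold deg_exp_coef.
rewrite fact_simpl, mult_INR; simpl gen_falling.
field; split; [apply INR_fact_neq_0|apply not_0_INR; lia].
Qed.

(** With parameter [- mu] the factors become [x + k mu], so none of them can vanish. *)
Lemma gen_falling_opp_pos (mu x : R) (n : nat) :
  0 <= mu -> 0 < x -> 0 < gen_falling (- mu) x n.
Proof.
intros Hmu Hx; induction n as [|n IH]; simpl; [lra|].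
apply Rmult_lt_0_compat; [exact IH|].
assert (H := pos_INR n); nra.
Qed.

(** Factor by factor, [|x - k lam| <= z + k |lam|]. *)
Lemma Rabs_gen_falling_le (lam x z : R) (n : nat) :
  Rabs x <= z -> Rabs (gen_falling lam x n) <= gen_falling (- Rabs lam) z n.
Proof.
intros Hz; induction n as [|n IH]; simpl; [rewrite Rabs_R1; lra|].
rewrite Rabs_mult.
apply Rmult_le_compat; try apply Rabs_pos; [exact IH|].
unfold Rminus; eapply Rle_trans; [apply Rabs_triang|].
rewrite Rabs_Ropp, Rabs_mult, (Rabs_right (INR n)) by (apply Rle_ge, pos_INR).
lra.
Qed.

Lemma is_lim_seq_deg_exp_ratio (mu x : R) :
  is_lim_seq (fun n => (x + INR n * mu) / INR (S n)) mu.
Proof.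
apply is_lim_seq_ext with (u := fun n => mu + (x - mu) * / INR (S n)).
- intros n; assert (H := not_0_INR (S n) ltac:(lia)).
  rewrite S_INR in *; field; exact H.
- replace (Finite mu) with (Finite (mu + (x - mu) * 0)) by (f_equal; ring).
  apply is_lim_seq_plus'; [apply is_lim_seq_const|].
  apply is_lim_seq_mult'; [apply is_lim_seq_const|].
  apply (is_lim_seq_inv (fun n => INR (S n)) p_infty); [|discriminate].
  apply (is_lim_seq_incr_1 INR), is_lim_seq_INR.
Qed.

(* The coefficients vanish from some index on when [x / lam] is a natural number,
so the ratio test is applied to the positive majorant [deg_exp_coef (- |lam|) z]. *)
Lemma CV_disk_deg_exp_coef (lam x t : R) :
  Rabs (lam * t) < 1 -> CV_disk (deg_exp_coef lam x) t.
Proof.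
intros Ht.
(* The [+ 1] keeps [z] positive even for [x = 0], so the ratios [c (S n) / c n] make sense. *)
set (mu := Rabs lam); set (z := Rabs x + 1).
assert (Hmu : 0 <= mu) by apply Rabs_pos.
assert (Hz : 0 < z) by (assert (H := Rabs_pos x); unfold z; lra).
set (c := deg_exp_coef (- mu) z).
assert (Hc : forall n, 0 < c n).
{ intros n; apply Rdiv_lt_0_compat;
    [now apply gen_falling_opp_pos|apply INR_fact_lt_0]. }
assert (Hcv : CV_disk c t).
{ apply CV_disk_DAlembert with mu.
  - intros n; apply Rgt_not_eq, Hc.
  - apply is_lim_seq_ext with (u := fun n => (z + INR n * mu) / INR (S n));
      [|apply is_lim_seq_deg_exp_ratio].
    intros n.
    rewrite Rabs_right by (apply Rle_ge, Rlt_le, Rdiv_lt_0_compat; apply Hc).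
    assert (HS := not_0_INR (S n) ltac:(lia)).
    assert (Hn := Rgt_not_eq _ _ (Hc n)).
    apply Rmult_eq_reg_l with (INR (S n)); [|exact HS].
    replace (INR (S n) * (c (S n) / c n)) with (INR (S n) * c (S n) / c n)
      by (field; exact Hn).
    unfold c at 1; rewrite deg_exp_coef_succ; fold c.
    field; auto.
  (* A zero limit of the ratios means an infinite radius; otherwise the radius is [1 / mu]. *)
  - destruct (Req_dec mu 0) as [H0|H0]; [now left|right; split; [exact H0|]].
    apply Rmult_lt_reg_l with mu; [lra|].
    rewrite Rinv_r by exact H0; unfold mu; rewrite <- Rabs_mult; exact Ht. }
revert Hcv; unfold CV_disk.
apply (ex_series_le (V := R_CompleteNormedModule)); intros n.
change (Rabs (Rabs (deg_exp_coef lam x n * t ^ n)) <= Rabs (c n * t ^ n)).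
rewrite Rabs_Rabsolu, !Rabs_mult.
apply Rmult_le_compat_r; [apply Rabs_pos|].
rewrite (Rabs_right (c n)) by (apply Rle_ge, Rlt_le, Hc).
unfold c, deg_exp_coef, Rdiv.
rewrite Rabs_mult, (Rabs_right (/ _)) by
  (apply Rle_ge, Rlt_le, Rinv_0_lt_compat, INR_fact_lt_0).
apply Rmult_le_compat_r;
  [apply Rlt_le, Rinv_0_lt_compat, INR_fact_lt_0|].
apply Rabs_gen_falling_le; unfold z; lra.
Qed.

(** * Application to the degenerate exponential *)

(** The weight is absorbed into the argument: this is absolute convergence at [t * r]. *)
Lemma ex_series_deg_exp_weighted (lam x t r : R) :
  0 <= r -> Rabs (lam * t) * r < 1 ->
  ex_series (fun k => Rabs (deg_exp_coef lam x k * t ^ k) * r ^ k).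
Proof.
intros Hr Ht.
assert (H : Rabs (lam * (t * r)) < 1)
  by (rewrite <- Rmult_assoc, Rabs_mult, (Rabs_right r); lra).
apply ex_series_ext with (2 := CV_disk_deg_exp_coef lam x _ H).
intros k; rewrite Rpow_mult_distr, <- Rmult_assoc, (Rabs_mult _ (r ^ k)).
now rewrite (Rabs_right (r ^ k)) by (now apply Rle_ge, pow_le).
Qed.

Lemma exists_weight_gt_1 (q : R) : 0 <= q -> q < 1 -> exists r, 1 < r /\ q * r < 1.
Proof.
(* The witness is the reciprocal of the midpoint of [q] and 1. *)
intros H0 H1; exists (2 / (1 + q)); split.
- apply Rmult_lt_reg_r with (1 + q); [lra|].
  replace (2 / (1 + q) * (1 + q)) with 2 by (field; lra); lra.
- apply Rmult_lt_reg_r with (1 + q); [lra|].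
  replace (q * (2 / (1 + q)) * (1 + q)) with (q * 2) by (field; lra); lra.
Qed.

Lemma Series_INR_mul_deg_exp_coef (lam y : R) :
  Rabs (lam * y) < 1 ->
  Series (fun k => INR k * (deg_exp_coef lam 1 k * y ^ k)) =
  y / (1 + lam * y) * deg_exp lam y.
Proof.
intros Hy.
destruct (exists_weight_gt_1 _ (Rabs_pos _) Hy) as [r [Hr Hyr]].
assert (Hv := ex_series_deg_exp_weighted lam 1 y r ltac:(lra) Hyr).
assert (Hu := ex_series_of_weighted _ r ltac:(lra) Hv).
assert (Hb := ex_series_INR_mul _ r Hr Hv).
assert (Hne : 1 + lam * y <> 0) by (apply Rabs_def2 in Hy; lra).
set (u := fun k => deg_exp_coef lam 1 k * y ^ k) in *.
change (Series (fun k => INR k * u k) = y / (1 + lam * y) * Series u).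
set (B := Series (fun k => INR k * u k)).
assert (HB : B = y * Series u - lam * y * B).
(* The term at [k = 0] vanishes; after the shift, the recurrence turns the term of index [k + 1]
   into [y (1 - k lam) u k], which splits into the two series on the right. *)
{ unfold B at 1; rewrite Series_incr_1 by exact Hb.
  unfold B; rewrite <- !Series_scal_l, <- Series_minus;
    [|exact (ex_series_scal_l (K := R_AbsRing) y _ Hu)
     |exact (ex_series_scal_l (K := R_AbsRing) (lam * y) _ Hb)].
  simpl INR at 1; rewrite Rmult_0_l, Rplus_0_l.
  apply Series_ext; intros k; unfold u.
  rewrite <- Rmult_assoc, deg_exp_coef_succ; simpl pow; ring. }
apply Rmult_eq_reg_l with (1 + lam * y); [|exact Hne].
replace ((1 + lam * y) * (y / (1 + lam * y) * Series u)) with (y * Series u)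
  by (field; exact Hne).
lra.
Qed.

Theorem theorem2p1 (lam x y : R) (hx : x <> 1)
    (hy : Rabs (lam * y) < 1) (hxy : Rabs (lam * x * y) < 1) :
  (forall n : nat,
      is_series (fun k : nat => deg_exp_coef lam 1 (n + 1 + k) * y ^ (n + 1 + k))
                (deg_exp_tail lam y n)) /\
  is_series (fun n : nat => deg_exp_tail lam y n * x ^ n)
            (1 / (x - 1) * (deg_exp lam (x * y) - deg_exp lam y)) /\
  is_series (fun n : nat => deg_exp_tail lam y n)
            (y / (1 + lam * y) * deg_exp lam y).
Proof.
set (u := fun k => deg_exp_coef lam 1 k * y ^ k).
assert (HT : forall n, deg_exp_tail lam y n = series_tail u n) by reflexivity.
destruct (exists_weight_gt_1 _ (Rabs_pos _) hy) as [r [Hr Hyr]].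
assert (Hv : ex_series (fun k => Rabs (u k) * r ^ k))
  by (apply ex_series_deg_exp_weighted; [lra|exact Hyr]).
split; [|split].
- intros n.
  apply is_series_ext with (a := fun k => u (S n + k)%nat).
  + intros k; unfold u; now replace (n + 1 + k)%nat with (S n + k)%nat by lia.
  + apply is_series_series_tail, (ex_series_of_weighted u r); [lra|exact Hv].
- replace (deg_exp lam (x * y)) with (Series (fun k => u k * x ^ k)).
  + apply is_series_series_tail_mul_pow; [exact hx|].
    apply ex_series_deg_exp_weighted.
    * apply Rle_trans with 1; [lra|apply Rmax_l].
    (* The two values of the maximum correspond to [hy] and [hxy]. *)
    * apply Rmax_case; [lra|].
      rewrite <- Rabs_mult; now replace (lam * y * x) with (lam * x * y) by ring.
  + apply Series_ext; intros k; unfold u; rewrite Rpow_mult_distr; ring.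
- rewrite <- Series_INR_mul_deg_exp_coef by exact hy.
  exact (is_series_sum_series_tail u r Hr Hv).
Qed.
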